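(* Let $f=f_1\wedge f_2\wedge\cdots\wedge f_m:\{0,1\}^n\to\{0,1\}$, where each $f_i$ is computable by a width-2 read-once branching program and the $f_i$ depend on pairwise disjoint sets of input variables. Then there exists a $\mathsf{CNF}^\oplus$ formula $g:\{0,1\}^n\to\{0,1\}$ such that $g\le f$ pointwise and $\mathbb{E}[g]\ge\mathbb{E}[f]^{O(1)}$.
   Context: A read-once branching program of width $d$ and length $n$ has layers $V_0=\{(0,0)\}$, $V_t=\{(t,i)\}_{i\in[d]}$ ($1\le t\le n-1$), $V_n=\{(n,1),(n,d)\}$ (accept and reject), each vertex of $V_t$ having out-edges labeled $0,1$ into $V_{t+1}$; from layer $t$ the edge labeled $x_{t+1}$ is followed and $x$ is accepted iff the path ends at $(n,1)$. A $\mathsf{CNF}^\oplus$ formula is a conjunction $\bigwedge_i T_i$ where each $T_i$ is a disjunction of literals or a parity of literals, the $T_i$ on pairwise disjoint variables. $\mathbb{E}$ is under the uniform distribution. *)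

(* Defs.v *)
From HB Require Import structures.
From mathcomp Require Import all_boot all_order all_algebra.

Set Implicit Arguments.
Unset Strict Implicit.
Unset Printing Implicit Defensive.

(* The input bits x_1, ..., x_n are indexed from 0: x_{t+1} is [x t]. *)
Definition cube (n : nat) := {ffun 'I_n -> bool}.

Definition expectation (n : nat) (f : cube n -> bool) : rat :=
  ((\sum_(x : cube n) (f x)%:R) / #|{: cube n}|%:R)%R.

(* [in_layer d n t v] says that the vertex (t, v) belongs to V_t; the second
   components of the vertices keep their labels 0, 1, ..., d. *)
Definition in_layer (d n t v : nat) : bool :=
  if t == 0 then v == 0
  else if t < n then 1 <= v <= d
  else (v == 1) || (v == d).

(* [edge t v b] is the label of the head, in V_{t+1}, of the edge labeled [b]
   leaving (t, v); its values at pairs (t, v) outside V_t are irrelevant. *)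
Record robp (d n : nat) := Robp {
  edge : 'I_n -> nat -> bool -> nat;
  edge_in_layer : forall (t : 'I_n) (v : nat) (b : bool),
    in_layer d n t v -> in_layer d n t.+1 (edge t v b)
}.

(* [enum 'I_n] is increasing, so the bits are read in the order of the input. *)
Definition robp_end (d n : nat) (B : robp d n) (x : cube n) : nat :=
  foldl (fun v t => edge B t v (x t)) 0 (enum 'I_n).

Definition robp_accepts (d n : nat) (B : robp d n) (x : cube n) : bool :=
  robp_end B x == 1.

Definition robp_computable (d n : nat) (f : cube n -> bool) : Prop :=
  exists B : robp d n, forall x : cube n, f x = robp_accepts B x.

Definition flip (n : nat) (j : 'I_n) (x : cube n) : cube n :=
  [ffun k => if k == j then ~~ x k else x k].

Definition dep_vars (n : nat) (f : cube n -> bool) : {set 'I_n} :=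
  [set j | [exists x : cube n, f (flip j x) != f x]].

(* [(j, false)] is the literal x_j and [(j, true)] is its negation. *)
Definition literal (n : nat) : finType := ('I_n * bool)%type.

Definition literal_eval (n : nat) (l : literal n) (x : cube n) : bool :=
  x l.1 (+) l.2.

Inductive term (n : nat) :=
  | Disjunction of {set literal n}
  | Parity of {set literal n}.

Definition term_eval (n : nat) (T : term n) (x : cube n) : bool :=
  match T with
  | Disjunction L => [exists l in L, literal_eval l x]
  | Parity L => \big[addb/false]_(l in L) literal_eval l x
  end.

Definition term_vars (n : nat) (T : term n) : {set 'I_n} :=
  match T with Disjunction L | Parity L => [set l.1 | l in L] end.

(* Empty terms are allowed and evaluate to false, so that the constant 0 is
   always a formula; the empty conjunction is the constant 1. *)
Record cnf_xor (n : nat) := CnfXor {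
  terms : seq (term n);
  terms_disjoint :
    pairwise (fun T T' => [disjoint term_vars T & term_vars T']) terms
}.

Definition cnf_xor_eval (n : nat) (F : cnf_xor n) (x : cube n) : bool :=
  all (fun T => term_eval T x) (terms F).

(* Main.v *)
(** Reading a width-2 read-once program one bit at a time, the state is a bit
    [s], updated to [l && s], [l || s] or [l (+) s] up to negation, where [l] is
    a literal on a fresh variable. Unfolding [f_i] from its last update:
    a conjunction [l && s] is handled by recursion on [s];
    a maximal block of disjunctions [l_1 || ... || l_k || s] has probability at
    most [1 - 2^-(k+1)] unless it is a constant or itself a disjunction, so
    [l_1 || ... || l_k], of probability [1 - 2^-k], is large enough;
    a maximal block of parities has probability [1/2] and becomes a pure parity
    of literals once a single further literal is fixed, which leaves probability
    at least [1/4]. In all cases the exponent [3] works, and it is preserved by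
    conjunctions over disjoint variables, by independence. *)

Require Import Defs.
From HB Require Import structures.
From mathcomp Require Import all_boot all_order all_algebra.
From mathcomp Require Import lra.

Set Implicit Arguments.
Unset Strict Implicit.
Unset Printing Implicit Defensive.

Import Order.TTheory GRing.Theory Num.Theory.

(** * Dependence on a set of coordinates *)

Definition depends_on n (A : {set 'I_n}) (f : cube n -> bool) : Prop :=
  forall x y : cube n, {in A, x =1 y} -> f x = f y.

Lemma depends_onS n (A B : {set 'I_n}) (f : cube n -> bool) :
  A \subset B -> depends_on A f -> depends_on B f.
Proof. by move=> /subsetP sAB fA x y xy; apply: fA => k /sAB; apply: xy. Qed.

Lemma flipK n (j : 'I_n) : involutive (flip j).
Proof. by move=> x; apply/ffunP=> k; rewrite !ffunE; case: eqP; rewrite ?negbK. Qed.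

(** Walk from [x] to [y] one coordinate at a time. Each real change is a flip at a coordinate where
    [x] and [y] differ, hence outside [dep_vars f], and such a flip preserves [f]. *)
Lemma depends_on_dep_vars n (f : cube n -> bool) : depends_on (dep_vars f) f.
Proof.
move=> x y xy.
pose z (s : seq 'I_n) : cube n := [ffun k => if k \in s then y k else x k].
have zE s : f (z s) = f x.
  elim: s => [|j s <-]; first by congr f; apply/ffunP=> k; rewrite ffunE.
  have [xyj | nxyj] := eqVneq (z s j) (y j).
    congr f; apply/ffunP=> k; move: xyj; rewrite !ffunE inE.
    by case: (eqVneq k j) => //= ->.
  have -> : z (j :: s) = flip j (z s).
    apply/ffunP=> k; move: nxyj; rewrite !ffunE inE.
    case: (eqVneq k j) => //= ->; case: ifP => _; first by rewrite eqxx.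
    by case: (x j) (y j) => [] [].
  apply/eqP; have : j \notin dep_vars f.
    apply: contraNN nxyj => jf; rewrite ffunE; case: ifP => // _.
    by rewrite (xy j jf).
  by rewrite inE negb_exists => /forallP/(_ (z s)); rewrite negbK.
rewrite -(zE (enum 'I_n)); congr f; apply/ffunP=> k.
by rewrite ffunE mem_enum.
Qed.

(** * Uniform expectation and independence *)

Section Expectation.
Variable n : nat.
Implicit Types (f g : cube n -> bool) (A B : {set 'I_n}) (l : literal n).
Local Open Scope ring_scope.

Lemma card_cube_gt0 : 0 < #|{: cube n}|%:R :> rat.
Proof. by rewrite ltr0n; apply/card_gt0P; exists [ffun=> false]. Qed.

Lemma eq_expectation f g : f =1 g -> expectation f = expectation g.
Proof. by move=> fg; congr (_ / _); apply: eq_bigr => x _; rewrite fg. Qed.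

Lemma expectation_ge0 f : 0 <= expectation f.
Proof. by rewrite divr_ge0 ?sumr_ge0 // => x _; rewrite ler0n. Qed.

Lemma le_expectation f g : (forall x, f x -> g x) -> expectation f <= expectation g.
Proof.
move=> fg; rewrite ler_pM2r ?invr_gt0 ?card_cube_gt0 //.
by apply: ler_sum => x _; rewrite ler_nat; have := fg x; case: (f x) => // ->.
Qed.

Lemma expectation_true f : (forall x, f x) -> expectation f = 1.
Proof.
move=> ft; rewrite /expectation (eq_bigr (fun=> 1)) => [|x _]; last by rewrite ft.
by rewrite sumr_const -/(_%:R) divff // gt_eqF // card_cube_gt0.
Qed.

Lemma expectation_false f : (forall x, f x = false) -> expectation f = 0.
Proof. by move=> ff; rewrite /expectation big1 ?mul0r // => x _; rewrite ff. Qed.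

Lemma expectation_neg f : expectation (fun x => ~~ f x) = 1 - expectation f.
Proof.
rewrite -(@expectation_true predT) // -mulrBl -sumrB; congr (_ / _).
by apply: eq_bigr => x _; case: (f x); rewrite /= ?subrr ?subr0.
Qed.

Lemma expectation_le1 f : expectation f <= 1.
Proof. by rewrite -subr_ge0 -expectation_neg expectation_ge0. Qed.

(* Exchanging the coordinates in [A] of two independent points preserves the
   uniform distribution on pairs. *)
Lemma expectation_and A B f g :
  [disjoint A & B] -> depends_on A f -> depends_on B g ->
  expectation (fun x => f x && g x) = expectation f * expectation g.
Proof.
move=> dAB fA gB.
pose mix (x y : cube n) : cube n := [ffun k => if k \in A then x k else y k].
pose swap (p : cube n * cube n) := (mix p.1 p.2, mix p.2 p.1).
have swapK : involutive swap.
  move=> [x y]; rewrite /swap /=; congr pair; apply/ffunP=> k; rewrite !ffunE.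
    by case: (k \in A).
  by case: (k \in A).
have fgE (p : cube n * cube n) : f (swap p).1 && g (swap p).1 = f p.1 && g p.2.
  congr andb; first by apply: fA => k kA; rewrite ffunE kA.
  apply: gB => k kB; rewrite ffunE ifN //.
  by apply: contraTN kB => /(disjointFr dAB) ->.
have : (\sum_x (f x)%:R) * (\sum_x (g x)%:R) =
       (\sum_x (f x && g x)%:R) * #|{: cube n}|%:R :> rat.
  rewrite big_distrlr pair_bigA /=.
  under eq_bigr => p _ do rewrite -natrM mulnb -fgE.
  rewrite -(reindex_inj (inv_inj swapK) (P := xpredT)
    (F := fun p : cube n * cube n => (f p.1 && g p.1)%:R)).
  rewrite -(pair_bigA _ (fun x _ => (f x && g x)%:R)) /= mulr_suml.
  by apply: eq_bigr => x _; rewrite sumr_const mulr_natr.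
rewrite /expectation => E; rewrite mulf_div E.
by rewrite -mulf_div divff ?mulr1 // gt_eqF // card_cube_gt0.
Qed.

(** Flipping coordinate [j] is a measure-preserving bijection that exchanges [f] with its
    negation. *)
Lemma expectation_flip (j : 'I_n) f :
  (forall x, f (flip j x) = ~~ f x) -> expectation f = 1 / 2.
Proof.
move=> fj; have : expectation f = expectation (fun x => ~~ f x).
  rewrite {1}/expectation (reindex_inj (inv_inj (@flipK n j))); congr (_ / _).
  by apply: eq_bigr => x _; rewrite fj.
rewrite expectation_neg; lra.
Qed.

Lemma literal_eval_flip l x : literal_eval l (flip l.1 x) = ~~ literal_eval l x.
Proof. by rewrite /literal_eval ffunE eqxx addNb. Qed.

Lemma expectation_literal l : expectation (literal_eval l) = 1 / 2.
Proof. exact: expectation_flip (literal_eval_flip l). Qed.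

Lemma depends_on_literal l : depends_on [set l.1] (literal_eval l).
Proof. by move=> x y xy; rewrite /literal_eval xy // set11. Qed.

Lemma depends_on_flip A f j x : j \notin A -> depends_on A f -> f (flip j x) = f x.
Proof.
move=> jA; apply=> k kA; rewrite ffunE ifN //.
by apply: contraNneq jA => <-.
Qed.

Lemma expectation_literal_and A l f : l.1 \notin A -> depends_on A f ->
  expectation (fun x => literal_eval l x && f x) = expectation f / 2.
Proof.
move=> lA fA; rewrite (@expectation_and [set l.1] A) //; last exact: depends_on_literal.
  by rewrite expectation_literal; lra.
by rewrite disjoints1.
Qed.

(** By De Morgan, failure of the disjunction is a conjunction with the opposite literal, so
    absorbing a fresh literal halves the failure probability. *)
Lemma expectation_literal_or A l f : l.1 \notin A -> depends_on A f ->
  1 - expectation (fun x => literal_eval l x || f x) = (1 - expectation f) / 2.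
Proof.
move=> lA fA; rewrite -!expectation_neg.
rewrite -(@expectation_literal_and A (l.1, ~~ l.2)) //.
  apply: eq_expectation => x.
  by rewrite negb_or /literal_eval; case: (x l.1) l.2 => [] [].
by move=> x y xy; rewrite (fA x y xy).
Qed.

Lemma expectation_literal_xor A l f : l.1 \notin A -> depends_on A f ->
  expectation (fun x => literal_eval l x (+) f x) = 1 / 2.
Proof.
move=> lA fA; apply: (@expectation_flip l.1) => x.
by rewrite literal_eval_flip (depends_on_flip _ lA fA) addNb.
Qed.

Lemma depends_on_term (T : term n) : depends_on (term_vars T) (term_eval T).
Proof.
move=> x y; case: T => L /= xy.
  by apply: eq_existsb => l; case lL: (l \in L); rewrite //= /literal_eval xy ?imset_f.
by apply: eq_bigr => l lL; rewrite /literal_eval xy ?imset_f.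
Qed.

End Expectation.

(** * Lower approximation by conjunctions of disjoint terms *)

Section Approximation.
Variable n : nat.
Implicit Types (f g : cube n -> bool) (A B : {set 'I_n}) (l : literal n).
Implicit Types (ts : seq (term n)).

Definition conj_eval ts (x : cube n) : bool := all (fun T => term_eval T x) ts.

Definition terms_over A ts : bool := all (fun T => term_vars T \subset A) ts.

Definition disjoint_terms ts : bool :=
  pairwise (fun T T' => [disjoint term_vars T & term_vars T']) ts.

Lemma depends_on_conj A ts : terms_over A ts -> depends_on A (conj_eval ts).
Proof.
move=> tsA x y xy; elim: ts tsA => //= T ts IH /andP[TA /IH ->].
by rewrite (depends_onS TA (@depends_on_term _ T) xy).
Qed.

Lemma terms_overS A B ts : A \subset B -> terms_over A ts -> terms_over B ts.
Proof. by move=> sAB; apply: sub_all => T /subset_trans; apply. Qed.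

Lemma disjoint_terms_cat A B ts ts' :
  [disjoint A & B] -> terms_over A ts -> terms_over B ts' ->
  disjoint_terms ts -> disjoint_terms ts' -> disjoint_terms (ts ++ ts').
Proof.
move=> dAB tsA tsB dts dts'; rewrite /disjoint_terms pairwise_cat.
apply/and3P; split=> //; apply: sub_all tsA => T TA; apply: sub_all tsB => T' TB.
exact: disjointW TA TB dAB.
Qed.

(** Confining the terms to [A] is what lets approximations over disjoint sets be concatenated. *)
Definition approximable A f : Prop :=
  exists ts, [/\ disjoint_terms ts, terms_over A ts,
    forall x, conj_eval ts x -> f x
    & (expectation f ^+ 3 <= expectation (conj_eval ts))%R].

Lemma eq_approximable A f g : f =1 g -> approximable A f -> approximable A g.
Proof.
move=> fg [ts [dts tsA tsf tsE]]; exists ts; split=> // [x /tsf|]; first by rewrite fg.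
by rewrite -(eq_expectation fg).
Qed.

Lemma approximable_true A f : (forall x, f x) -> approximable A f.
Proof.
move=> ft; exists [::]; split=> //.
by rewrite !expectation_true // expr1n.
Qed.

Lemma approximable_false A f : (forall x, f x = false) -> approximable A f.
Proof.
move=> ff; exists [:: Disjunction set0]; split=> //.
- by rewrite /= imset0 sub0set.
- by move=> x /andP[/existsP[l]]; rewrite inE.
- by rewrite expectation_false // expr0n expectation_ge0.
Qed.

Lemma disjunction_set0 (x : cube n) : term_eval (Disjunction set0) x = false.
Proof. by apply/existsP=> -[l]; rewrite inE. Qed.

Lemma disjunction_setU1 l (L : {set literal n}) x :
  term_eval (Disjunction (l |: L)) x = literal_eval l x || term_eval (Disjunction L) x.
Proof.
apply/existsP/orP => [[k /andP[]] | [lx | /existsP[k /andP[kL kx]]]].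
- by case/setU1P=> [-> ->|kL kx]; [left | right; apply/existsP; exists k; rewrite kL].
- by exists l; rewrite setU11.
- by exists k; rewrite kx setU1r.
Qed.

Lemma disjunction_set1 l x : term_eval (Disjunction [set l]) x = literal_eval l x.
Proof. by rewrite -[[set l]]setU0 disjunction_setU1 disjunction_set0 orbF. Qed.

Lemma approximable_literal l : approximable [set l.1] (literal_eval l).
Proof.
exists [:: Disjunction [set l]].
have tE x : conj_eval [:: Disjunction [set l]] x = literal_eval l x.
  by rewrite -disjunction_set1 /conj_eval /= andbT.
split=> // [|x|]; first by rewrite /= andbT imset_set1.
  by rewrite tE.
by rewrite (eq_expectation tE) expectation_literal; lra.
Qed.

(** Independence makes both sides of the cubic bound multiplicative, so the exponent does not
    grow. *)
Lemma approximable_and A B f g :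
  [disjoint A & B] -> depends_on A f -> depends_on B g ->
  approximable A f -> approximable B g ->
  approximable (A :|: B) (fun x => f x && g x).
Proof.
move=> dAB fA gB [ts [dts tsA tsf tsE]] [us [dus usB usg usE]].
exists (ts ++ us); split.
- exact: disjoint_terms_cat tsA usB dts dus.
- rewrite /terms_over all_cat; apply/andP; split.
    exact: terms_overS (subsetUl _ _) tsA.
  exact: terms_overS (subsetUr _ _) usB.
- by move=> x; rewrite /conj_eval all_cat => /andP[/tsf -> /usg ->].
- rewrite (expectation_and dAB) // exprMn.
  rewrite (@eq_expectation _ (conj_eval (ts ++ us))
    (fun x => conj_eval ts x && conj_eval us x)) => [|x]; last exact: all_cat.
  rewrite (expectation_and dAB); try exact: depends_on_conj.
  by apply: ler_pM; rewrite ?exprn_ge0 ?expectation_ge0.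
Qed.

(** * Chains of literal updates *)

(* [chain A f]: [f] is built from a constant by absorbing one literal at a time,
   on pairwise distinct variables taken from [A]. *)
Inductive chain : {set 'I_n} -> (cube n -> bool) -> Prop :=
  | ChainConst A f c of (forall x, f x = c) : chain A f
  | ChainAnd A l f g of l.1 \in A & chain (A :\ l.1) f
      & (forall x, g x = literal_eval l x && f x) : chain A g
  | ChainOr A l f g of l.1 \in A & chain (A :\ l.1) f
      & (forall x, g x = literal_eval l x || f x) : chain A g
  | ChainXor A l f g of l.1 \in A & chain (A :\ l.1) f
      & (forall x, g x = literal_eval l x (+) f x) : chain A g.

Lemma eq_chain A f g : f =1 g -> chain A f -> chain A g.
Proof.
move=> fg cf; case: cf fg => {}A.
- by move=> h c hE fg; apply: (@ChainConst A g c) => x; rewrite -fg.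
- by move=> l h k lA ch kE fg; apply: (ChainAnd lA ch) => x; rewrite -fg.
- by move=> l h k lA ch kE fg; apply: (ChainOr lA ch) => x; rewrite -fg.
- by move=> l h k lA ch kE fg; apply: (ChainXor lA ch) => x; rewrite -fg.
Qed.

Lemma chainS A B f : A \subset B -> chain A f -> chain B f.
Proof.
move=> + cf; elim: cf B => {A f} A.
- by move=> f c fE B _; apply: (@ChainConst B f c).
- move=> l f g lA _ IH gE B sAB; have lB := subsetP sAB _ lA.
  by apply: (ChainAnd lB _ gE); apply/IH/setSD.
- move=> l f g lA _ IH gE B sAB; have lB := subsetP sAB _ lA.
  by apply: (ChainOr lB _ gE); apply/IH/setSD.
- move=> l f g lA _ IH gE B sAB; have lB := subsetP sAB _ lA.
  by apply: (ChainXor lB _ gE); apply/IH/setSD.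
Qed.

Lemma chain_neg A f : chain A f -> chain A (fun x => ~~ f x).
Proof.
elim=> {A f} A.
- by move=> f c fE; apply: (@ChainConst A _ (~~ c)) => x; rewrite fE.
- move=> l f g lA _ IH gE; apply: (@ChainOr A (l.1, ~~ l.2) _ _ lA IH) => x.
  by rewrite gE /literal_eval /= addbN negb_and.
- move=> l f g lA _ IH gE; apply: (@ChainAnd A (l.1, ~~ l.2) _ _ lA IH) => x.
  by rewrite gE /literal_eval /= addbN negb_or.
- move=> l f g lA _ IH gE; apply: (@ChainXor A l _ _ lA IH) => x.
  by rewrite gE addbN.
Qed.

Lemma chain_unary A f (u : bool -> bool) : chain A f -> chain A (fun x => u (f x)).
Proof.
move=> cf; case ut: (u true); case uf: (u false).
- by apply: (@ChainConst _ _ true) => x; case: (f x).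
- by apply: eq_chain cf => x; case: (f x).
- by apply: eq_chain (chain_neg cf) => x; case: (f x).
- by apply: (@ChainConst _ _ false) => x; case: (f x).
Qed.

(** Fixing the bit [x j] turns [phi] into two unary maps of the state. If one is constant, the
    update is a conjunction or disjunction of a literal on [j] with the other. Otherwise each is the
    identity or the negation: they coincide and the bit is ignored, or they are complementary and
    the update is a parity. *)
Lemma chain_update A f j (phi : bool -> bool -> bool) :
  j \notin A -> chain A f -> chain (j |: A) (fun x => phi (f x) (x j)).
Proof.
move=> jA cf.
have jU : j \in j |: A := setU11 _ _.
have sU : A \subset j |: A := subsetUr _ _.
have cu u : chain ((j |: A) :\ j) (fun x => u (f x)) by rewrite setU1K //; apply: chain_unary.
have phiE s b : phi s b = if s then (if b then phi true true else phi true false)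
  else (if b then phi false true else phi false false) by case: s b => [] [].
(* Each of the sixteen truth tables is closed by one of the six forms tried below. *)
move: phiE; case: (phi true true) (phi true false) (phi false true) (phi false false)
  => [] [] [] [] phiE.
all: solve [
  (  apply: (eq_chain _ (chainS sU (chain_unary (phi ^~ true) cf)))
   + apply: (@ChainXor _ (j, false) _ _ jU (cu (phi ^~ false)))
   + apply: (@ChainAnd _ (j, false) _ _ jU (cu (phi ^~ true)))
   + apply: (@ChainAnd _ (j, true) _ _ jU (cu (phi ^~ false)))
   + apply: (@ChainOr _ (j, false) _ _ jU (cu (phi ^~ false)))
   + apply: (@ChainOr _ (j, true) _ _ jU (cu (phi ^~ true))));
  by move=> x; rewrite /literal_eval !phiE; case: (f x) (x j) => [] []].
Qed.

Lemma depends_on_chain A f : chain A f -> depends_on A f.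
Proof.
elim=> {A f} A.
- by move=> f c fE x y _; rewrite !fE.
all: move=> l f g lA _ IH gE x y xy; rewrite !gE.
all: rewrite (IH x y) => [|k /setD1P[_ kA]]; last exact: xy.
all: by rewrite /literal_eval xy.
Qed.

(** * Approximating chains *)

Lemma term_vars_setU1 A l (L : {set literal n}) : l.1 \in A ->
  [set k.1 | k in L] \subset A :\ l.1 -> [set k.1 | k in l |: L] \subset A.
Proof.
move=> lA LA; rewrite imsetU1 subUset sub1set lA.
exact: subset_trans LA (subD1set _ _).
Qed.

(** The factor 2 compares failure probabilities. The empty disjunction suffices when [f] has
    expectation at most 1/2, as after a conjunction, a parity or the constant false; each further
    disjunction halves both sides. *)
Lemma chain_disjunction A f : chain A f -> (forall x, f x) \/
  exists L : {set literal n},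
    [/\ term_vars (Disjunction L) \subset A,
        forall x, term_eval (Disjunction L) x -> f x
      & (1 - expectation (term_eval (Disjunction L)) <= 2 * (1 - expectation f))%R].
Proof.
have small B g : (expectation g <= 1 / 2)%R -> exists L : {set literal n},
    [/\ term_vars (Disjunction L) \subset B,
        forall x, term_eval (Disjunction L) x -> g x
      & (1 - expectation (term_eval (Disjunction L)) <= 2 * (1 - expectation g))%R].
  move=> gE; exists set0; split=> [|x|]; first by rewrite /= imset0 sub0set.
    by rewrite disjunction_set0.
  by rewrite (expectation_false disjunction_set0); lra.
elim=> {A f} A.
- move=> f [] fE; first by left=> x; rewrite fE.
  by right; apply: small; rewrite expectation_false //; lra.
- move=> l f g lA cf _ gE; right; apply: small; rewrite -(expectation_literal l).
  by apply: le_expectation => x; rewrite gE => /andP[].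
- move=> l f g lA cf [ft | [L [LA Lf LE]]] gE; first by left=> x; rewrite gE ft orbT.
  right; exists (l |: L); split; first exact: term_vars_setU1.
    by move=> x; rewrite disjunction_setU1 gE => /orP[-> // | /Lf ->]; rewrite orbT.
  have nl : l.1 \notin A :\ l.1 by rewrite setD11.
  rewrite (eq_expectation gE) (eq_expectation (disjunction_setU1 l L)).
  rewrite !(expectation_literal_or nl); first by lra.
    exact: depends_on_chain.
  exact: depends_onS LA (@depends_on_term _ _).
- move=> l f g lA cf _ gE; right; apply: small.
  rewrite (eq_expectation gE) (@expectation_literal_xor _ (A :\ l.1)) ?setD11 //.
  exact: depends_on_chain.
Qed.

Lemma parity_setU1 l (L : {set literal n}) x : l \notin L ->
  term_eval (Parity (l |: L)) x = literal_eval l x (+) term_eval (Parity L) x.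
Proof. by move=> lL; rewrite /= big_setU1. Qed.

(* [ts] fixes the literal of the last conjunction or disjunction absorbed, if
   there is one; the literals absorbed after it form the parity. *)
Lemma chain_parity A f : chain A f -> exists (L : {set literal n}) c ts,
  [/\ term_vars (Parity L) \subset A,
      disjoint_terms ts /\ terms_over (A :\: term_vars (Parity L)) ts,
      (1 / 2 <= expectation (conj_eval ts))%R
    & forall x, conj_eval ts x -> f x = c (+) term_eval (Parity L) x].
Proof.
(* A single literal that forces [g] to a constant leaves an empty parity and has probability 1/2. *)
have fix_literal B g l c : l.1 \in B -> (forall x, literal_eval l x -> g x = c) ->
    exists (L : {set literal n}) c ts,
    [/\ term_vars (Parity L) \subset B,
      disjoint_terms ts /\ terms_over (B :\: term_vars (Parity L)) ts,
      (1 / 2 <= expectation (conj_eval ts))%R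
    & forall x, conj_eval ts x -> g x = c (+) term_eval (Parity L) x].
  move=> lB gE; exists set0, c, [:: Disjunction [set l]]; split.
  - by rewrite /= imset0 sub0set.
  - by rewrite /= imset0 setD0 imset_set1 sub1set lB.
  - rewrite -(expectation_literal l); apply: le_expectation => x.
    by rewrite -disjunction_set1 /conj_eval /= andbT.
  - by move=> x /andP[+ _]; rewrite disjunction_set1 /= big_set0 addbF; apply: gE.
elim=> {A f} A.
- move=> f c fE; exists set0, c, [::]; split=> //; first by rewrite /= imset0 sub0set.
    by rewrite expectation_true //; lra.
  by move=> x _; rewrite fE /= big_set0 addbF.
(* A conjunction is forced to false by the opposite literal; a disjunction, next, is forced to true
   by the literal itself. *)
- move=> l f g lA _ _ gE; apply: (@fix_literal _ _ (l.1, ~~ l.2) false) => // x.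
  by rewrite gE /literal_eval /= addbN => /negPf->.
- by move=> l f g lA _ _ gE; apply: (@fix_literal _ _ l true) => // x; rewrite gE => ->.
- move=> l f g lA _ [L [c [ts [LA [dts tsA] tsE tsf]]]] gE.
  exists (l |: L), c, ts; split=> //; first exact: term_vars_setU1.
    split=> //; apply: terms_overS tsA.
    by rewrite /= imsetU1 setDDl.
  have lL : l \notin L.
    by apply: contraTN LA => lL; apply/subsetPn; exists l.1; rewrite ?imset_f ?setD11.
  by move=> x /tsf fx; rewrite gE fx (parity_setU1 x lL) addbCA.
Qed.

(** Only an outermost conjunction uses the induction hypothesis; an outermost disjunction or parity
    is handled by the analysis of the remaining chain in [chain_disjunction] or [chain_parity]. *)
Lemma approximable_chain A f : chain A f -> approximable A f.
Proof.
elim=> {A f} A.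
- move=> f [] fE; first by apply: approximable_true => x; rewrite fE.
  exact: approximable_false.
- move=> l f g lA cf IH gE.
  apply: (@eq_approximable _ (fun x => literal_eval l x && f x)) => //.
  rewrite -(setD1K lA); apply: (approximable_and _ _ _ _ IH); last exact: approximable_literal.
  + by rewrite disjoints1 setD11.
  + exact: depends_on_literal.
  + exact: depends_on_chain.
- move=> l f g lA cf _ gE; have [ft | [L [LA Lf LE]]] := chain_disjunction cf.
    by apply: approximable_true => x; rewrite gE ft orbT.
  have nl : l.1 \notin A :\ l.1 by rewrite setD11.
  exists [:: Disjunction (l |: L)]; split=> //.
  + by rewrite /terms_over /= andbT; apply: term_vars_setU1.
  + move=> x /andP[]; rewrite disjunction_setU1 gE => /orP[-> // | /Lf ->] _.
    by rewrite orbT.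
  + have tE x : conj_eval [:: Disjunction (l |: L)] x =
        literal_eval l x || term_eval (Disjunction L) x.
      by rewrite -disjunction_setU1 /conj_eval /= andbT.
    rewrite (eq_expectation gE) (eq_expectation tE).
    have := expectation_literal_or nl (depends_on_chain cf).
    have := expectation_literal_or nl (depends_onS LA (@depends_on_term _ _)).
    have := expectation_ge0 (term_eval (Disjunction L)).
    have := expectation_le1 (term_eval (Disjunction L)).
    have := expectation_ge0 f; move: LE.
    set p := expectation f; set q := expectation (term_eval _).
    set q' := expectation _; set p' := expectation _ => LE p0 q1 q0 qE pE.
    have -> : q' = ((1 + q) / 2)%R by lra.
    have p'q : (p' <= (3 + q) / 4)%R by lra.
    have p'0 : (0 <= p')%R by lra.
    (* The left side is convex in [q] and [(1 + q) / 2] is linear, so the endpoints decide: 27/64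
       against 1/2 at 0, equality at 1. A square would fail at 0, since 9/16 exceeds 1/2. *)
    apply: le_trans (_ : ((3 + q) / 4) ^+ 3 <= _)%R.
      by rewrite ler_pXn2r // nnegrE; lra.
    by nra.
- move=> l f g lA cf _ gE; have [L [c [ts [LA [dts tsA] tsE tsf]]]] := chain_parity cf.
  have nl : l.1 \notin A :\ l.1 by rewrite setD11.
  (* Both polarities are excluded because the constant [c] is absorbed below into the sign of
     [l]. *)
  have nlL d : (l.1, d) \notin L.
    by apply: contraTN LA => lL; apply/subsetPn; exists l.1; rewrite ?setD11 //;
       apply/imsetP; exists (l.1, d).
  pose P := Parity ((l.1, l.2 (+) c) |: L).
  have PE x : term_eval P x = literal_eval l x (+) (c (+) term_eval (Parity L) x).
    by rewrite parity_setU1 // /literal_eval /= !addbA.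
  have PA : term_vars P \subset A by apply: term_vars_setU1.
  have dPts : [disjoint term_vars P & A :\ l.1 :\: term_vars (Parity L)].
    rewrite /= imsetU1 setDDl disjoint_sym disjoints_subset.
    by apply/subsetP=> k; rewrite !inE => /andP[].
  exists (P :: ts); split.
  + rewrite -cat1s; apply: disjoint_terms_cat dPts _ tsA _ dts => //.
    by rewrite /terms_over /= andbT.
  + rewrite /terms_over /= PA; apply: terms_overS tsA.
    by rewrite setDDl subsetDl.
  + by move=> x /andP[+ /tsf fx]; rewrite PE gE fx.
  (* The target is (1/2)^3 = 1/8, while the parity has probability 1/2 and is independent of [ts],
     giving at least 1/4. *)
  + rewrite (eq_expectation gE) (expectation_literal_xor nl); last exact: depends_on_chain.
    rewrite (expectation_and dPts); last exact: depends_on_conj.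
      rewrite (eq_expectation PE) (expectation_literal_xor nl); first by lra.
      move=> x y xy; congr addb.
      exact: (depends_onS LA (@depends_on_term _ (Parity L))).
    exact: depends_on_term.
Qed.

End Approximation.

(** * From width-2 programs to chains *)

(* The state bit is [true] at the vertex labelled 1; the bit of the initial
   vertex, labelled 0, is [false]. *)
Lemma robp2_foldl n (B : robp 2 n) : exists step : 'I_n -> bool -> bool -> bool,
  forall x, robp_accepts B x = foldl (fun s t => step t s (x t)) false (enum 'I_n).
Proof.
pose vertex (t : nat) (s : bool) := if t == 0 then 0 else if s then 1 else 2.
pose step (t : 'I_n) s b := edge B t (vertex t s) b == 1.
exists step => x; rewrite /robp_accepts /robp_end.
(* Generalised to a run over consecutive layers from [t]. Knowing that [v] lies in its layer lets
   [vertex] recover it from the bit [v == 1]. *)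
have run (r : seq 'I_n) t v : map val r = iota t (size r) -> in_layer 2 n t v ->
    (foldl (fun v t => edge B t v (x t)) v r == 1) =
    foldl (fun s t => step t s (x t)) (v == 1) r.
  elim: r t v => //= i r IH t v [it rE] vt; subst t.
  rewrite (IH _ _ rE); last exact: edge_in_layer.
  congr foldl; rewrite /step; suff -> : vertex i (v == 1) = v by [].
  move: vt; rewrite /in_layer /vertex; case: eqP => [_ /eqP-> // | _].
  by rewrite ltn_ord; case: v => [|[|[|]]].
by rewrite (run _ 0) // val_enum_ord size_enum_ord.
Qed.

(** Bits outside [S] are read as false, so their steps are unary and consume no variable. Induction
    is from the right because the last update is the outermost link of the chain. *)
Lemma chain_foldl n (S : {set 'I_n}) (step : 'I_n -> bool -> bool -> bool) s0 r :
  uniq r ->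
  chain (S :&: [set t in r])
    (fun x => foldl (fun s t => step t s ((t \in S) && x t)) s0 r).
Proof.
elim/last_ind: r => [_|r t IH]; first by apply: (@ChainConst _ _ _ s0).
rewrite rcons_uniq => /andP[tr /IH cr].
have rE : [set u in rcons r t] = t |: [set u in r].
  by apply/setP=> u; rewrite !inE mem_rcons inE.
have tS' : t \notin S :&: [set u in r] by rewrite !inE (negPf tr) andbF.
case tS: (t \in S).
  rewrite rE setIUr (setIidPr _) ?sub1set //.
  apply: eq_chain (chain_update (step t) tS' cr) => x.
  by rewrite foldl_rcons tS.
have sub : S :&: [set u in r] \subset S :&: [set u in rcons r t].
  by rewrite rE setIS // subsetUr.
apply: eq_chain (chainS sub (chain_unary (step t ^~ false) cr)) => x.
by rewrite foldl_rcons tS.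
Qed.

(** The program may read every coordinate, but zeroing those outside [dep_vars f] preserves [f]; the
    resulting chain uses only variables of [dep_vars f]. *)
Lemma approximable_robp2 n (f : cube n -> bool) :
  robp_computable 2 f -> approximable (dep_vars f) f.
Proof.
move=> [B fB]; have [step stepE] := robp2_foldl B; set S := dep_vars f.
have := chain_foldl S step false (enum_uniq 'I_n).
move=> /(chainS (subsetIl _ _)) cf; apply: approximable_chain; apply: eq_chain cf => x.
pose xS : cube n := [ffun t => (t \in S) && x t].
rewrite -(@depends_on_dep_vars _ f xS x) => [|t tS]; last by rewrite ffunE tS.
rewrite fB stepE; elim: (enum _) false => //= t r IH s.
by rewrite ffunE IH.
Qed.

(** * Conjunction of the approximations *)

Theorem theorem6p12 :
  exists C : nat,
    forall (n m : nat) (f : cube n -> bool) (fs : 'I_m -> cube n -> bool),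
      (forall x : cube n, f x = [forall i : 'I_m, fs i x]) ->
      (forall i : 'I_m, robp_computable 2 (fs i)) ->
      (forall i j : 'I_m, i != j ->
         [disjoint dep_vars (fs i) & dep_vars (fs j)]) ->
      exists g : cnf_xor n,
        (forall x : cube n, cnf_xor_eval g x <= f x) /\
        (expectation f ^+ C <= expectation (cnf_xor_eval g))%R.
Proof.
exists 3 => n m f fs fE fB dfs.
pose A (r : seq 'I_m) := \bigcup_(i <- r) dep_vars (fs i).
have all_dep r : depends_on (A r) (fun x => all (fs^~ x) r).
  move=> x y; elim: r => //= i r IH; rewrite /A big_cons => xy.
  rewrite IH => [|k kA]; last by rewrite xy // inE kA orbT.
  by rewrite (@depends_on_dep_vars _ (fs i) x y) // => k kA; rewrite xy // inE kA.
have all_approx r : uniq r -> approximable (A r) (fun x => all (fs^~ x) r).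
  elim: r => [_|i r IH /= /andP[ir /IH ar]]; first exact: approximable_true.
  rewrite /A big_cons; apply: (approximable_and _ _ (all_dep r) _ ar).
  (* As [i] does not occur in [r], pairwise disjointness extends to the union over [r]. *)
  - rewrite /A; elim: r ir {IH ar} => [_|j r IH].
      by rewrite big_nil disjoints_subset setC0 subsetT.
    rewrite inE negb_or big_cons => /andP[ij /IH ir].
    rewrite disjoints_subset setCU subsetI -!disjoints_subset ir andbT.
    exact: dfs.
  - exact: depends_on_dep_vars.
  - exact: approximable_robp2.
have [ts [dts _ tsf tsE]] := all_approx _ (enum_uniq 'I_m).
have fallE x : f x = all (fs^~ x) (enum 'I_m).
  by rewrite fE; apply/forallP/allP => [h i _ | h i]; [|apply: h; rewrite mem_enum].
exists (CnfXor dts); split=> [x|]; last by rewrite (eq_expectation fallE).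
by rewrite fallE; have := tsf x; rewrite /cnf_xor_eval /conj_eval /=; case: all => // ->.
Qed.
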